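(* The following set of 28 elements is a linear basis over $K=\mathbb{C}(u)$ of ${\rm YTL}_{2,3}(u)$: $$\begin{aligned}\mathcal{S}_{2,3}=\{&1,\ t_1,\ t_2,\ t_1t_2,\ g_1,\ t_2g_1,\ t_3g_1,\ t_2t_3g_1,\ g_2,\ t_1g_2,\ t_3g_2,\ t_1t_3g_2,\\ &g_1g_2,\ t_1g_1g_2,\ t_2g_1g_2,\ t_3g_1g_2,\ t_1t_2g_1g_2,\ t_1t_3g_1g_2,\ t_2t_3g_1g_2,\ t_1t_2t_3g_1g_2,\\ &g_2g_1,\ t_1g_2g_1,\ t_2g_2g_1,\ t_3g_2g_1,\ t_1t_2g_2g_1,\ t_1t_3g_2g_1,\ t_2t_3g_2g_1,\ t_1t_2t_3g_2g_1\}.\end{aligned}$$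
   Context: Let $u$ be an indeterminate and $K=\mathbb{C}(u)$. The Yokonuma--Temperley--Lieb algebra ${\rm YTL}_{2,3}(u)$ (case $d=2$, $n=3$) is the associative unital $K$-algebra generated by $g_1,g_2,t_1,t_2,t_3$ subject to: $g_1g_2g_1=g_2g_1g_2$; $g_i^2=1+(u-1)e_i+(u-1)e_ig_i$ for $i=1,2$, where $e_i=\frac12(1+t_it_{i+1})$; $t_it_j=t_jt_i$ for all $i,j$; $t_i^2=1$; $g_it_i=t_{i+1}g_i$; $g_it_{i+1}=t_ig_i$; $g_it_j=t_jg_i$ for $j\ne i,i+1$; and $g_1g_2g_1+g_1g_2+g_2g_1+g_1+g_2+1=0$. *)

(* Defs.v *)
From HB Require Import structures.
From mathcomp Require Import all_boot all_order all_algebra.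
From mathcomp Require Import boolp reals.
From mathcomp Require Import complex.
From mathcomp Require Import ring.
From mathcomp Require Import monalg.

Set Implicit Arguments.
Unset Strict Implicit.
Unset Printing Implicit Defensive.

Import GRing.Theory.
Import Quotient.

Local Open Scope ring_scope.
Local Open Scope quotient_scope.

(* The free associative unital K-algebra on X: the monoid algebra of words. *)
Notation free_alg K X := {malg K[{fmonom X}]}.

Definition free_gen (K : fieldType) (X : choiceType) (x : X) : free_alg K X :=
  mkmalgU (fmu x) 1.
Arguments free_gen : clear implicits.

Section PresentedAlgebra.

Variables (K : fieldType) (X : choiceType).
Notation F := (free_alg K X).
Variable rel : F -> F -> Prop.

(* The two-sided ideal generated by the differences x - y with rel x y. *)
Inductive rel_ideal : F -> Prop :=
| RelIdeal_rel x y : rel x y -> rel_ideal (x - y)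
| RelIdeal_0 : rel_ideal 0
| RelIdeal_B x y : rel_ideal x -> rel_ideal y -> rel_ideal (x - y)
| RelIdeal_M a x b : rel_ideal x -> rel_ideal (a * x * b).

Definition rel_ideal_pred : pred F := fun x => `[< rel_ideal x >].

Lemma rel_idealP (x : F) : reflect (rel_ideal x) (x \in rel_ideal_pred).
Proof. exact: asboolP. Qed.

Lemma rel_ideal_zmod_closed : zmod_closed rel_ideal_pred.
Proof.
split=> [|x y /rel_idealP Ix /rel_idealP Iy]; apply/rel_idealP.
  exact: RelIdeal_0.
exact: RelIdeal_B.
Qed.

HB.instance Definition _ :=
  GRing.isZmodClosed.Build F rel_ideal_pred rel_ideal_zmod_closed.

Definition rel_ideal_zmod : zmodClosed F :=
  GRing.ZmodClosed.clone F rel_ideal_pred _.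

Definition presented_alg : Type := {quot rel_ideal_zmod}.
HB.instance Definition _ := GRing.Zmodule.on presented_alg.
HB.instance Definition _ : EqQuotient F (equiv rel_ideal_zmod) presented_alg :=
  EqQuotient.on presented_alg.

Implicit Types (x y z : F) (p q r : presented_alg).

Definition pres_class x : presented_alg := \pi_presented_alg x.

Lemma pres_class_surj p : exists x, p = pres_class x.
Proof. by exists (repr p); rewrite /pres_class reprK. Qed.

Lemma pres_classE x y : pres_class x = pres_class y <-> rel_ideal (x - y).
Proof.
rewrite /pres_class; split=> [/eqP | /rel_idealP Ixy].
  by rewrite eqmodE => /rel_idealP.
by apply/eqP; rewrite eqmodE.
Qed.

Lemma pres_classD x y : pres_class (x + y) = pres_class x + pres_class y.
Proof. exact: (raddfD \pi_({quot rel_ideal_zmod})). Qed.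

Definition pres_mul p q := pres_class (repr p * repr q).
Definition pres_one := pres_class 1.
Definition pres_scale (k : K) p := pres_class (k *: repr p).

Lemma pres_repr x : rel_ideal (repr (pres_class x) - x).
Proof. by apply/pres_classE; rewrite /pres_class reprK. Qed.

Lemma rel_idealD x y : rel_ideal x -> rel_ideal y -> rel_ideal (x + y).
Proof.
by move=> /rel_idealP Ix /rel_idealP Iy; apply/rel_idealP; rewrite rpredD.
Qed.

Lemma pres_mulE x y :
  pres_mul (pres_class x) (pres_class y) = pres_class (x * y).
Proof.
apply/pres_classE; set x' := repr _; set y' := repr _.
have -> : x' * y' - x * y = 1 * (x' - x) * y' + x * (y' - y) * 1.
  by rewrite mul1r mulr1 mulrBl mulrBr addrA subrK.
by apply: rel_idealD; apply: RelIdeal_M; apply: pres_repr.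
Qed.

Lemma pres_scaleE k x : pres_scale k (pres_class x) = pres_class (k *: x).
Proof.
apply/pres_classE; rewrite -scalerBr.
rewrite -[_ - _]mulr1 -[X in k *: X]mul1r mulrA scalerAl scalerAl.
by apply: RelIdeal_M; apply: pres_repr.
Qed.

Lemma pres_mulA : associative pres_mul.
Proof.
move=> p q r; have [[x ->] [[y ->] [z ->]]] :=
  (pres_class_surj p, (pres_class_surj q, pres_class_surj r)).
by rewrite !pres_mulE mulrA.
Qed.

Lemma pres_mul1r : left_id pres_one pres_mul.
Proof.
by move=> p; have [x ->] := pres_class_surj p; rewrite pres_mulE mul1r.
Qed.

Lemma pres_mulr1 : right_id pres_one pres_mul.
Proof.
by move=> p; have [x ->] := pres_class_surj p; rewrite pres_mulE mulr1.
Qed.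

Lemma pres_mulDl : left_distributive pres_mul +%R.
Proof.
move=> p q r; have [[x ->] [[y ->] [z ->]]] :=
  (pres_class_surj p, (pres_class_surj q, pres_class_surj r)).
by rewrite -pres_classD !pres_mulE -pres_classD mulrDl.
Qed.

Lemma pres_mulDr : right_distributive pres_mul +%R.
Proof.
move=> p q r; have [[x ->] [[y ->] [z ->]]] :=
  (pres_class_surj p, (pres_class_surj q, pres_class_surj r)).
by rewrite -pres_classD !pres_mulE -pres_classD mulrDr.
Qed.

HB.instance Definition _ := GRing.Zmodule_isPzRing.Build presented_alg
  pres_mulA pres_mul1r pres_mulr1 pres_mulDl pres_mulDr.

Lemma pres_scaleA a b p :
  pres_scale a (pres_scale b p) = pres_scale (a * b) p.
Proof.
by have [x ->] := pres_class_surj p; rewrite !pres_scaleE scalerA.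
Qed.

Lemma pres_scale1r : left_id 1 pres_scale.
Proof.
by move=> p; have [x ->] := pres_class_surj p; rewrite pres_scaleE scale1r.
Qed.

Lemma pres_scaleDr : right_distributive pres_scale +%R.
Proof.
move=> k p q; have [[x ->] [y ->]] := (pres_class_surj p, pres_class_surj q).
by rewrite -pres_classD !pres_scaleE -pres_classD scalerDr.
Qed.

Lemma pres_scaleDl p : {morph pres_scale^~ p : a b / a + b}.
Proof.
move=> a b /=; have [x ->] := pres_class_surj p.
by rewrite !pres_scaleE -pres_classD scalerDl.
Qed.

HB.instance Definition _ := GRing.Zmodule_isLmodule.Build K presented_alg
  pres_scaleA pres_scale1r pres_scaleDr pres_scaleDl.

Lemma pres_scaleAl (k : K) p q : k *: (p * q) = (k *: p) * q.
Proof.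
have [[x ->] [y ->]] := (pres_class_surj p, pres_class_surj q).
rewrite [LHS](congr1 (pres_scale k) (pres_mulE x y)) pres_scaleE scalerAl.
by rewrite [k *: _ in RHS]pres_scaleE [RHS]pres_mulE.
Qed.

Lemma free_scaleAr (k : K) x y : k *: (x * y) = x * (k *: y).
Proof.
have C z : k%:MP * z = z * k%:MP.
  rewrite [LHS]fgmulUg [RHS]fgmulgU; apply: eq_bigr => m _.
  by rewrite mul1m mulm1 mulrC.
by rewrite -[LHS]mul_malgC -[k *: y]mul_malgC !mulrA C.
Qed.

Lemma pres_scaleAr (k : K) p q : k *: (p * q) = p * (k *: q).
Proof.
have [[x ->] [y ->]] := (pres_class_surj p, pres_class_surj q).
rewrite [LHS](congr1 (pres_scale k) (pres_mulE x y)) pres_scaleE free_scaleAr.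
by rewrite [k *: _ in RHS]pres_scaleE [RHS]pres_mulE.
Qed.

End PresentedAlgebra.

Section YokonumaTemperleyLieb.

Variables (K : fieldType) (u : K).

(* inl i stands for g_{i+1}, inr j for t_{j+1}. *)
Notation F := (free_alg K ('I_2 + 'I_3)%type).
Notation g i := (free_gen K ('I_2 + 'I_3)%type (inl i)).
Notation t j := (free_gen K ('I_2 + 'I_3)%type (inr j)).

(* For i : 'I_2 indexing g_i, the indices of t_i and t_{i+1}. *)
Definition t_cur (i : 'I_2) : 'I_3 := widen_ord (leqnSn 2) i.
Definition t_next (i : 'I_2) : 'I_3 := lift ord0 i.

Definition free_e (i : 'I_2) : F := 2^-1 *: (1 + t (t_cur i) * t (t_next i)).

Inductive ytl_rel : F -> F -> Prop :=
| Ytl_braid : ytl_rel (g 0 * g 1 * g 0) (g 1 * g 0 * g 1)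
| Ytl_quadratic i :
    ytl_rel (g i ^+ 2) (1 + (u - 1) *: free_e i + (u - 1) *: (free_e i * g i))
| Ytl_tC i j : ytl_rel (t i * t j) (t j * t i)
| Ytl_t2 j : ytl_rel (t j ^+ 2) 1
| Ytl_gt_cur i : ytl_rel (g i * t (t_cur i)) (t (t_next i) * g i)
| Ytl_gt_next i : ytl_rel (g i * t (t_next i)) (t (t_cur i) * g i)
| Ytl_gt_other i j : j != t_cur i -> j != t_next i ->
    ytl_rel (g i * t j) (t j * g i)
| Ytl_steinberg :
    ytl_rel (g 0 * g 1 * g 0 + g 0 * g 1 + g 1 * g 0 + g 0 + g 1 + 1) 0.

Definition ytl23 : Type := presented_alg ytl_rel.
HB.instance Definition _ := GRing.PzRing.on ytl23.
HB.instance Definition _ := GRing.Lmodule.on ytl23.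

(* The quotient is not the zero ring: g_i |-> -1, t_j |-> 1 is a character. *)
Definition ytl_char_word (m : {fmonom ('I_2 + 'I_3)%type}) : K :=
  \prod_(x <- m : seq _) (if x is inl _ then -1 else 1).

Lemma ytl_char_word_mmorphism : mmorphism ytl_char_word.
Proof.
split=> [m n|]; rewrite /ytl_char_word; first by rewrite fmM big_cat.
by rewrite fm1 big_nil.
Qed.

HB.instance Definition _ :=
  isMultiplicative.Build _ K ytl_char_word ytl_char_word_mmorphism.

Definition ytl_char : F -> K := mmap idfun ytl_char_word.
HB.instance Definition _ := GRing.RMorphism.on ytl_char.

Lemma ytl_charZ k (x : F) : ytl_char (k *: x) = k * ytl_char x.
Proof. exact: mmapZ. Qed.

Lemma ytl_char_gen x :
  ytl_char (free_gen K _ x) = if x is inl _ then -1 else 1.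
Proof.
by rewrite /ytl_char mmapU mul1r /= /ytl_char_word fmU big_seq1.
Qed.

Lemma char_relE (A : lalgType K) (f : {rmorphism A -> K})
    (fZ : forall k a, f (k *: a) = k * f a) (a b c d : A) :
  f a = -1 -> f b = -1 -> f c = 1 -> f d = 1 ->
  [/\ f (a * b * a) = f (b * a * b),
      f (a ^+ 2) = f (1 + (u - 1) *: (2^-1 *: (1 + c * d))
                        + (u - 1) *: (2^-1 *: (1 + c * d) * a)),
      f (c * d) = f (d * c) /\ f (c ^+ 2) = f 1,
      f (a * c) = f (d * a)
    & f (a * b * a + a * b + b * a + a + b + 1) = f 0].
Proof.
move=> fa fb fc fd.
by rewrite !(rmorph0, rmorphD, rmorphM, rmorphXn, fZ, rmorph1, fa, fb, fc, fd);
  split; try split; ring.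
Qed.

Lemma ytl_char_rel x y : ytl_rel x y -> ytl_char x = ytl_char y.
Proof.
have fg i : ytl_char (g i) = -1 by rewrite ytl_char_gen.
have ft j : ytl_char (t j) = 1 by rewrite ytl_char_gen.
have relE := @char_relE _ ytl_char ytl_charZ.
case=> [|i|i j|j|i|i|i j _ _|].
- have [+ _ _ _ _] := relE _ _ _ _ (fg 0) (fg 1) (ft 0) (ft 0); exact.
- have [_ + _ _ _] := relE _ _ _ _ (fg i) (fg i) (ft (t_cur i)) (ft (t_next i)).
  exact.
- have [_ _ [+ _] _ _] := relE _ _ _ _ (fg 0) (fg 0) (ft i) (ft j); exact.
- have [_ _ [_ +] _ _] := relE _ _ _ _ (fg 0) (fg 0) (ft j) (ft j); exact.
- have [_ _ _ + _] := relE _ _ _ _ (fg i) (fg i) (ft (t_cur i)) (ft (t_next i)).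
  exact.
- have [_ _ _ + _] := relE _ _ _ _ (fg i) (fg i) (ft (t_next i)) (ft (t_cur i)).
  exact.
- have [_ _ _ + _] := relE _ _ _ _ (fg i) (fg i) (ft j) (ft j); exact.
- have [_ _ _ _ +] := relE _ _ _ _ (fg 0) (fg 1) (ft 0) (ft 0); exact.
Qed.

Lemma ytl_char_ideal x : rel_ideal ytl_rel x -> ytl_char x = 0.
Proof.
elim=> [{}x y /ytl_char_rel xy||{}x y _ x0 _ y0|a {}x b _ x0].
- by rewrite (rmorphB ytl_char) /= xy subrr.
- exact: (rmorph0 ytl_char).
- by rewrite (rmorphB ytl_char) /= x0 y0 subrr.
- by rewrite !(rmorphM ytl_char) /= x0 mulr0 mul0r.
Qed.

Lemma ytl_oner_neq0 : (1 : ytl23) != 0.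
Proof.
have E0 : (0 : ytl23) = pres_class ytl_rel 0 by rewrite -pi_zeror.
apply/eqP; rewrite E0 => /pres_classE /ytl_char_ideal/eqP.
by rewrite subr0 (rmorph1 ytl_char) oner_eq0.
Qed.

HB.instance Definition _ := GRing.PzSemiRing_isNonZero.Build ytl23 ytl_oner_neq0.
HB.instance Definition _ :=
  GRing.Lmodule_isLalgebra.Build K ytl23 (@pres_scaleAl K _ ytl_rel).
HB.instance Definition _ :=
  GRing.Lalgebra_isAlgebra.Build K ytl23 (@pres_scaleAr K _ ytl_rel).

Definition ytl_g (i : 'I_2) : ytl23 := pres_class ytl_rel (g i).
Definition ytl_t (j : 'I_3) : ytl23 := pres_class ytl_rel (t j).

Definition ytl_S : 28.-tuple ytl23 :=
  let g1 := ytl_g 0 in let g2 := ytl_g 1 in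
  let t1 := ytl_t 0 in let t2 := ytl_t 1 in let t3 := ytl_t 2 in
  [tuple 1; t1; t2; t1 * t2;
    g1; t2 * g1; t3 * g1; t2 * t3 * g1;
    g2; t1 * g2; t3 * g2; t1 * t3 * g2;
    g1 * g2; t1 * g1 * g2; t2 * g1 * g2; t3 * g1 * g2;
    t1 * t2 * g1 * g2; t1 * t3 * g1 * g2; t2 * t3 * g1 * g2;
    t1 * t2 * t3 * g1 * g2;
    g2 * g1; t1 * g2 * g1; t2 * g2 * g1; t3 * g2 * g1;
    t1 * t2 * g2 * g1; t1 * t3 * g2 * g1; t2 * t3 * g2 * g1;
    t1 * t2 * t3 * g2 * g1].

End YokonumaTemperleyLieb.

Section LinearBasis.

Variables (A : pzRingType) (V : lmodType A) (n : nat) (s : n.-tuple V).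

Definition linearly_independent : Prop :=
  forall c : 'I_n -> A, \sum_i c i *: tnth s i = 0 -> forall i, c i = 0.

Definition spanning : Prop :=
  forall v : V, exists c : 'I_n -> A, v = \sum_i c i *: tnth s i.

Definition linear_basis : Prop := linearly_independent /\ spanning.

End LinearBasis.

Notation ratfunC R := {fraction {poly R[i]%C}}.

Definition ratfunC_u (R : realType) : ratfunC R := tofrac 'X.

(* Main.v *)
Require Import Defs.
From mathcomp Require Import all_boot all_order all_algebra.
From mathcomp Require Import reals.
From HB Require Import structures.
From mathcomp Require Import ring complex monalg.

Set Implicit Arguments.
Unset Strict Implicit.
Unset Printing Implicit Defensive.

Import GRing.Theory.
Local Open Scope ring_scope.

(** Write T for the commutative subalgebra generated by t1, t2, t3, whose
characters are the sign triples, and E for the idempotent of such a triple.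

Spanning. Multiplying the Steinberg relation by some t_i on the left and some
t_j on the right, and subtracting it from the result, cancels g1 g2 g1 and
leaves three relations with coefficients in T between the words 1, g1, g2,
g1 g2, g2 g1 ([stein_t2], [stein_t13], [stein_t31]). At a triple with one
isolated sign, according to its position, they express E g1 or E g2 through
E g1 g2 and E g2 g1, or E through E g1 and E g2. For the words g1, g2 and 1 this
replaces one of t1, t2, t3 by another one, so four of the eight monomials of T
suffice in front of them ([stab_g1], [stab_g2], [stab_1]). The span of
the 28 elements is thus T + T g1 + T g2 + T g1 g2 + T g2 g1. It contains
g1 g2 g1 by the Steinberg relation, hence is a left ideal ([span_closed]), and
it contains 1.

Independence. For signs x and y there is a representation on a space with
basis v1, v2, v3 in which t_j multiplies v_j by y and the two other vectors by
x ([rep_rels]). For y = x it is the reduction to the Hecke algebra, acting by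
the q-permutation module twisted by the sign; for y = - x the idempotent e_i
kills the two vectors that g_i moves, and g_i acts by a signed permutation. On
a linear combination of the 28 elements, the coefficient of a word becomes a
diagonal matrix, whose entries are the values of a polynomial in the signs.
The nine matrix entries give equations between these values ([rep_rows]), and
the equations for all x and y force every value to vanish, provided that u is
not zero. A multilinear polynomial that vanishes at all signs is zero, as 2 is
invertible ([sign4_eq0], [sign8_eq0]). *)

(** * Presented algebras *)

Section FreeEvaluation.

Variables (K : fieldType) (X : choiceType) (B : algType K) (f : X -> B).
Notation F := (free_alg K X).

Definition word_eval (m : {fmonom X}) : B := \prod_(x <- m : seq X) f x.

Lemma word_eval_mmorphism : mmorphism word_eval.
Proof.
split=> [m n|]; rewrite /word_eval; first by rewrite fmM big_cat.
by rewrite fm1 big_nil.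
Qed.

HB.instance Definition _ :=
  isMultiplicative.Build _ B word_eval word_eval_mmorphism.

Definition free_eval : F -> B := mmap (in_alg B) word_eval.

Lemma free_eval_monoid : monoid_morphism free_eval.
Proof.
split; first exact: mmap1.
apply: (commr_mmap_is_multiplicative (f := in_alg B) (h := word_eval) _).1.
by move=> g m m'; rewrite /GRing.comm /= -scalerAl -scalerAr mul1r mulr1.
Qed.

HB.instance Definition _ := Algebra.Additive.on free_eval.
HB.instance Definition _ :=
  GRing.isMonoidMorphism.Build F B free_eval free_eval_monoid.

Lemma free_evalZ k : {morph free_eval : x / k *: x}.
Proof. by move=> x; rewrite /free_eval mmapZ /= -scalerAl mul1r. Qed.

Lemma free_eval_gen x : free_eval (free_gen K X x) = f x.
Proof.
by rewrite /free_eval mmapU /= scale1r mul1r /word_eval fmU big_seq1.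
Qed.

End FreeEvaluation.

Section PresentedAlgebraTheory.

Variables (K : fieldType) (X : choiceType).
Notation F := (free_alg K X).
Variable rel : F -> F -> Prop.

(** The universal property of an algebra given by generators and relations. *)
Lemma presented_alg_lift (B : algType K) (f : X -> B) :
    (forall x y, rel x y -> free_eval f x = free_eval f y) ->
  exists phi : presented_alg rel -> B,
    [/\ forall x, phi (pres_class rel x) = free_eval f x, phi 1 = 1,
        {morph phi : p q / p * q} & linear phi].
Proof.
move=> frel; have f0 x : rel_ideal rel x -> free_eval f x = 0.
  elim=> [{}x y /frel xy||{}x y _ x0 _ y0|a {}x b _ x0].
  - by rewrite rmorphB /= xy subrr.
  - exact: rmorph0.
  - by rewrite rmorphB /= x0 y0 subrr.
  - by rewrite !rmorphM /= x0 mulr0 mul0r.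
pose phi (p : presented_alg rel) := free_eval f (generic_quotient.repr p).
have phiE x : phi (pres_class rel x) = free_eval f x.
  by apply/eqP; rewrite -subr_eq0 -rmorphB /= f0 //; apply: pres_repr.
exists phi; split=> //; first by rewrite [LHS]phiE rmorph1.
  move=> p q; have [[x ->] [y ->]] := (pres_class_surj p, pres_class_surj q).
  by rewrite [X in phi X](pres_mulE rel x y) !phiE rmorphM.
move=> k p q; have [[x ->] [y ->]] := (pres_class_surj p, pres_class_surj q).
rewrite [k *: _](pres_scaleE rel k x) -pres_classD !phiE rmorphD /=.
by rewrite free_evalZ.
Qed.

(** The classes of the words span, and a word is a generator times a shorter
word; closure under multiplication by generators on the left is enough. *)
Lemma presented_alg_ind (P : presented_alg rel -> Prop) :
    (forall p q, P p -> P q -> P (p + q)) ->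
    (forall k p, P p -> P (k *: p)) -> P 1 ->
    (forall x p, P p -> P (pres_class rel (free_gen K X x) * p)) ->
  forall p, P p.
Proof.
move=> PD PZ P1 PM p; have [x ->] := pres_class_surj p.
have P0 : P 0 by rewrite -[0](scale0r (1 : presented_alg rel)); apply: PZ.
have Pword s : P (pres_class rel (mkmalgU (FMonom s) 1)).
  elim: s => [|i s IHs].
    have -> : FMonom [::] = mone :> {fmonom X}.
      by apply: val_inj; rewrite /= fm1.
    exact: P1.
  have -> : mkmalgU (FMonom (i :: s)) 1
      = free_gen K X i * mkmalgU (FMonom s) 1 :> F.
    rewrite /free_gen malgM_def fgmulUU mulr1; congr (mkmalgU _ 1).
    by apply: val_inj; rewrite /= fmM fmU.
  by rewrite -pres_mulE; apply: PM.
rewrite [x]monalgE; elim: (X in \sum_(k <- X) _) => [|[m] r IHr].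
  by rewrite big_nil -pi_zeror in P0 *.
rewrite big_cons pres_classD; apply: PD => //.
have -> : << x@_(FMonom m) *g FMonom m >>
    = x@_(FMonom m) *: << FMonom m >> :> F.
  by apply/malgP => k; rewrite mcoeffZ !mcoeffU mulrnAr mulr1.
by rewrite -pres_scaleE; apply: PZ.
Qed.

End PresentedAlgebraTheory.

(** * The relations among explicit elements of an algebra *)

(** The relation [R] is equality in an algebra, but it can also be the defining
relation itself, or equality of images, between elements of the free algebra.
So the relations can be moved along a morphism in both directions. *)
Record ytl_rels (K : fieldType) (u : K) (A : lalgType K)
    (R : A -> A -> Prop) (g1 g2 t1 t2 t3 : A) : Prop := YtlRels {
  ytl_braid : R (g1 * g2 * g1) (g2 * g1 * g2);
  ytl_quad1 : R (g1 ^+ 2)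
    (1 + (u - 1) *: (2^-1 *: (1 + t1 * t2))
       + (u - 1) *: (2^-1 *: (1 + t1 * t2) * g1));
  ytl_quad2 : R (g2 ^+ 2)
    (1 + (u - 1) *: (2^-1 *: (1 + t2 * t3))
       + (u - 1) *: (2^-1 *: (1 + t2 * t3) * g2));
  ytl_t12C : R (t1 * t2) (t2 * t1);
  ytl_t13C : R (t1 * t3) (t3 * t1);
  ytl_t23C : R (t2 * t3) (t3 * t2);
  ytl_t1K : R (t1 ^+ 2) (1);
  ytl_t2K : R (t2 ^+ 2) (1);
  ytl_t3K : R (t3 ^+ 2) (1);
  ytl_g1t1 : R (g1 * t1) (t2 * g1);
  ytl_g1t2 : R (g1 * t2) (t1 * g1);
  ytl_g1t3 : R (g1 * t3) (t3 * g1);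
  ytl_g2t1 : R (g2 * t1) (t1 * g2);
  ytl_g2t2 : R (g2 * t2) (t3 * g2);
  ytl_g2t3 : R (g2 * t3) (t2 * g2);
  ytl_stein : R (g1 * g2 * g1 + g1 * g2 + g2 * g1 + g1 + g2 + 1) (0) }.

Lemma ytl_rels_image (K : fieldType) (u : K) (F A : lalgType K)
    (R : F -> F -> Prop) (f : F -> A) (g1 g2 t1 t2 t3 : F) :
    (forall x y, R x y -> f x = f y) ->
    f 0 = 0 -> f 1 = 1 -> {morph f : x y / x + y} -> {morph f : x y / x * y} ->
    (forall k, {morph f : x / k *: x}) ->
  ytl_rels u R g1 g2 t1 t2 t3 ->
  ytl_rels u eq (f g1) (f g2) (f t1) (f t2) (f t3).
Proof.
move=> fR f0 f1 fD fM fZ [].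
do 16![move=> /fR; rewrite ?expr2 !(f0, f1, fD, fM, fZ) => ?].
by split; rewrite ?expr2.
Qed.

Lemma ytl_rels_preimage (K : fieldType) (u : K) (F A : lalgType K)
    (f : F -> A) (g1 g2 t1 t2 t3 : F) :
    f 0 = 0 -> f 1 = 1 -> {morph f : x y / x + y} -> {morph f : x y / x * y} ->
    (forall k, {morph f : x / k *: x}) ->
    ytl_rels u eq (f g1) (f g2) (f t1) (f t2) (f t3) ->
  ytl_rels u (fun x y => f x = f y) g1 g2 t1 t2 t3.
Proof.
move=> f0 f1 fD fM fZ [].
do 16![rewrite ?expr2 => ?].
by split; rewrite ?expr2 !(f0, f1, fD, fM, fZ).
Qed.

Definition ytl_words (A : pzRingType) (g1 g2 t1 t2 t3 : A) : 28.-tuple A :=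
  [tuple 1; t1; t2; t1 * t2;
    g1; t2 * g1; t3 * g1; t2 * t3 * g1;
    g2; t1 * g2; t3 * g2; t1 * t3 * g2;
    g1 * g2; t1 * g1 * g2; t2 * g1 * g2; t3 * g1 * g2;
    t1 * t2 * g1 * g2; t1 * t3 * g1 * g2; t2 * t3 * g1 * g2;
    t1 * t2 * t3 * g1 * g2;
    g2 * g1; t1 * g2 * g1; t2 * g2 * g1; t3 * g2 * g1;
    t1 * t2 * g2 * g1; t1 * t3 * g2 * g1; t2 * t3 * g2 * g1;
    t1 * t2 * t3 * g2 * g1].

Definition ytl_gen (A : Type) (g1 g2 t1 t2 t3 : A) (x : 'I_2 + 'I_3) : A :=
  match x with
  | inl i => tnth [tuple g1; g2] i
  | inr j => tnth [tuple t1; t2; t3] j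
  end.

Lemma ord2_cases (i : 'I_2) : i = 0 \/ i = 1.
Proof. by case: i => [[|[|//]] lt_i]; [left|right]; apply: val_inj. Qed.

Lemma ord3_cases (j : 'I_3) : [\/ j = 0, j = 1 | j = 2].
Proof.
case: j => [[|[|[|//]]] lt_j];
  [constructor 1|constructor 2|constructor 3]; exact: val_inj.
Qed.

Section Ytl23.

Variables (K : fieldType) (u : K).
Notation Y := (ytl23 u).
Notation cls := (pres_class (ytl_rel u)).

Lemma ytl23_rel x y : ytl_rel u x y -> cls x = cls y.
Proof. by move=> xy; apply/pres_classE; apply: RelIdeal_rel. Qed.

Lemma ytl23_clsD x y : cls (x + y) = (cls x : Y) + cls y.
Proof. exact: pres_classD. Qed.

Lemma ytl23_clsM x y : cls (x * y) = (cls x : Y) * cls y.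
Proof. by rewrite -[LHS]pres_mulE. Qed.

Lemma ytl23_clsZ k x : cls (k *: x) = k *: (cls x : Y).
Proof. by rewrite -[LHS]pres_scaleE. Qed.

Lemma ytl23_cls1 : cls 1 = 1 :> Y.
Proof. by []. Qed.

Lemma ytl23_cls0 : cls 0 = 0 :> Y.
Proof. by apply/esym; rewrite -pi_zeror. Qed.

Lemma ytl23_rels :
  ytl_rels u eq (ytl_g u 0) (ytl_g u 1) (ytl_t u 0) (ytl_t u 1) (ytl_t u 2).
Proof.
apply: (ytl_rels_image (R := ytl_rel u) (f := cls : _ -> Y)).
- exact: ytl23_rel.
- exact: ytl23_cls0.
- exact: ytl23_cls1.
- exact: ytl23_clsD.
- exact: ytl23_clsM.
- exact: ytl23_clsZ.
have c0 : t_cur 0 = 0 by apply: val_inj.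
have c1 : t_cur 1 = 1 by apply: val_inj.
have n0 : t_next 0 = 1 by apply: val_inj.
have n1 : t_next 1 = 2 by apply: val_inj.
split.
- exact: Ytl_braid.
- by have := Ytl_quadratic u 0; rewrite /free_e c0 n0.
- by have := Ytl_quadratic u 1; rewrite /free_e c1 n1.
- exact: Ytl_tC.
- exact: Ytl_tC.
- exact: Ytl_tC.
- exact: Ytl_t2.
- exact: Ytl_t2.
- exact: Ytl_t2.
- by have := Ytl_gt_cur u 0; rewrite c0 n0.
- by have := Ytl_gt_next u 0; rewrite c0 n0.
- exact: Ytl_gt_other.
- exact: Ytl_gt_other.
- by have := Ytl_gt_cur u 1; rewrite c1 n1.
- by have := Ytl_gt_next u 1; rewrite c1 n1.
- exact: Ytl_steinberg.
Qed.

(** The same 28 words make sense in every algebra with five chosen elements, so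
they can be transported along a morphism. *)
Lemma ytl_SE : ytl_S u =
  ytl_words (ytl_g u 0) (ytl_g u 1) (ytl_t u 0) (ytl_t u 1) (ytl_t u 2).
Proof. by []. Qed.

(** The sixteen relations between explicit generators imply the relations that
are indexed by ordinals. Reflexivity and symmetry account for the commutation
of t_i and t_j with i >= j. *)
Lemma ytl_rels_respect (R : free_alg K ('I_2 + 'I_3)%type -> _ -> Prop)
    (g := fun i => free_gen K ('I_2 + 'I_3)%type (inl i))
    (t := fun j => free_gen K ('I_2 + 'I_3)%type (inr j)) :
    (forall x, R x x) -> (forall x y, R x y -> R y x) ->
    ytl_rels u R (g 0) (g 1) (t 0) (t 1) (t 2) ->
  forall x y, ytl_rel u x y -> R x y.
Proof.
have c0 : t_cur 0 = 0 by apply: val_inj.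
have c1 : t_cur 1 = 1 by apply: val_inj.
have n0 : t_next 0 = 1 by apply: val_inj.
have n1 : t_next 1 = 2 by apply: val_inj.
move=> Rxx Rsym H x y; case.
- exact (ytl_braid H).
- move=> i; case: (ord2_cases i) => ->; rewrite /free_e ?c0 ?n0 ?c1 ?n1.
    exact (ytl_quad1 H).
  exact (ytl_quad2 H).
- move=> i j; case: (ord3_cases i) => ->; case: (ord3_cases j) => ->.
  + exact: Rxx.
  + exact (ytl_t12C H).
  + exact (ytl_t13C H).
  + exact (Rsym _ _ (ytl_t12C H)).
  + exact: Rxx.
  + exact (ytl_t23C H).
  + exact (Rsym _ _ (ytl_t13C H)).
  + exact (Rsym _ _ (ytl_t23C H)).
  + exact: Rxx.
- move=> j; case: (ord3_cases j) => ->.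
  + exact (ytl_t1K H).
  + exact (ytl_t2K H).
  + exact (ytl_t3K H).
- move=> i; case: (ord2_cases i) => ->; rewrite ?c0 ?n0 ?c1 ?n1.
    exact (ytl_g1t1 H).
  exact (ytl_g2t2 H).
- move=> i; case: (ord2_cases i) => ->; rewrite ?c0 ?n0 ?c1 ?n1.
    exact (ytl_g1t2 H).
  exact (ytl_g2t3 H).
- move=> i j; case: (ord2_cases i) => ->; rewrite ?c0 ?n0 ?c1 ?n1;
    case: (ord3_cases j) => -> ne1 ne2;
    try by [case/eqP: ne1 | case/eqP: ne2].
    exact (ytl_g1t3 H).
  exact (ytl_g2t1 H).
- exact (ytl_stein H).
Qed.

Lemma ytl23_lift (B : algType K) (g1 g2 t1 t2 t3 : B) :
    ytl_rels u eq g1 g2 t1 t2 t3 ->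
  exists2 phi : Y -> B, linear phi &
    [/\ phi 1 = 1, {morph phi : p q / p * q},
        phi (ytl_g u 0) = g1 /\ phi (ytl_g u 1) = g2
      & [/\ phi (ytl_t u 0) = t1, phi (ytl_t u 1) = t2
          & phi (ytl_t u 2) = t3]].
Proof.
move=> H; pose f := ytl_gen g1 g2 t1 t2 t3.
have [|phi [phiE phi1 phiM phiL]] := @presented_alg_lift _ _ (ytl_rel u) _ f.
  apply: (ytl_rels_respect (R := fun x y => free_eval f x = free_eval f y)).
  - by [].
  - by move=> x y /esym.
  apply: ytl_rels_preimage.
  - exact: rmorph0.
  - exact: rmorph1.
  - exact: rmorphD.
  - exact: rmorphM.
  - exact: free_evalZ.
  by rewrite !free_eval_gen.
exists phi => //; split=> //; first by split; rewrite phiE free_eval_gen.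
by split; rewrite phiE free_eval_gen.
Qed.

Lemma ytl23_ind (P : Y -> Prop) :
    (forall p q, P p -> P q -> P (p + q)) ->
    (forall k p, P p -> P (k *: p)) -> P 1 ->
    (forall p, P p -> P (ytl_g u 0 * p) /\ P (ytl_g u 1 * p)) ->
    (forall p, P p ->
       [/\ P (ytl_t u 0 * p), P (ytl_t u 1 * p) & P (ytl_t u 2 * p)]) ->
  forall p, P p.
Proof.
move=> PD PZ P1 Pg Pt; apply: presented_alg_ind => // -[i|j] p Pp.
  have [P0 P'] := Pg p Pp.
  by case: (ord2_cases i) => ->; [exact P0 | exact P'].
have [P0 P' P''] := Pt p Pp.
by case: (ord3_cases j) => ->; [exact P0 | exact P' | exact P''].
Qed.

End Ytl23.

(** * Spanning *)

Section InSpan.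

Variables (A : pzRingType) (V : lmodType A) (n : nat) (s : n.-tuple V).

Definition in_span (v : V) : Prop :=
  exists c : 'I_n -> A, v = \sum_i c i *: tnth s i.

Lemma in_spanD v w : in_span v -> in_span w -> in_span (v + w).
Proof.
move=> [c ->] [d ->]; exists (fun i => c i + d i).
by rewrite -big_split; apply: eq_bigr => i _; rewrite scalerDl.
Qed.

Lemma in_spanZ k v : in_span v -> in_span (k *: v).
Proof.
move=> [c ->]; exists (fun i => k * c i).
by rewrite scaler_sumr; apply: eq_bigr => i _; rewrite scalerA.
Qed.

Lemma in_span_tnth i : in_span (tnth s i).
Proof.
exists (fun j => (j == i)%:R); rewrite (bigD1 i) //= eqxx scale1r.
by rewrite big1 ?addr0 // => j /negPf ->; rewrite scale0r.
Qed.

Lemma in_span_nth i : (i < n)%N -> in_span (nth 0 s i).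
Proof.
by move=> lt_in; rewrite -(tnth_nth _ _ (Ordinal lt_in)); apply: in_span_tnth.
Qed.

Lemma in_span_ind (P : V -> Prop) :
    (forall v w, P v -> P w -> P (v + w)) -> (forall k v, P v -> P (k *: v)) ->
    P 0 -> (forall i, (i < n)%N -> P (nth 0 s i)) ->
  forall v, in_span v -> P v.
Proof.
move=> PD PZ P0 Ps v [c ->]; elim/big_ind: _ => // i _.
by apply: PZ; rewrite (tnth_nth 0); apply: Ps.
Qed.

End InSpan.

(** Here [W] is any subspace; [tstable] says that it contains all eight products
of [v] with monomials in three commuting involutions. The booleans are the
exponents. *)
Section TorusStable.

Variables (K : fieldType) (A : algType K) (W : A -> Prop).
Hypothesis WD : forall v w, W v -> W w -> W (v + w).
Hypothesis WZ : forall (k : K) v, W v -> W (k *: v).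

Definition tstable a b c (v : A) : Prop :=
  forall i j k : bool, W (a ^+ i * (b ^+ j * (c ^+ k * v))).

Lemma mul_involX (x v : A) (i : bool) :
  x ^+ 2 = 1 -> x * (x ^+ i * v) = x ^+ (~~ i) * v.
Proof.
by rewrite expr2 mulrA; case: i => xx; rewrite ?expr1 ?expr0 ?mulr1 ?xx.
Qed.

Lemma mul_commX (x y v : A) (i : bool) :
  x * y = y * x -> x * (y ^+ i * v) = y ^+ i * (x * v).
Proof.
by rewrite mulrA => xy; rewrite (commrX i (xy : GRing.comm x y)) mulrA.
Qed.

Section Fixed.

Variables a b c : A.
Hypotheses (aK : a ^+ 2 = 1) (bK : b ^+ 2 = 1) (cK : c ^+ 2 = 1).
Hypotheses (abC : a * b = b * a) (acC : a * c = c * a) (bcC : b * c = c * b).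
Notation stab := (tstable a b c).

Lemma tstableW v : stab v -> W v.
Proof. by move=> /(_ false false false); rewrite !expr0 !mul1r. Qed.

Lemma tstableD v w : stab v -> stab w -> stab (v + w).
Proof. by move=> sv sw i j k; rewrite !mulrDr; apply: WD. Qed.

Lemma tstableZ (k : K) v : stab v -> stab (k *: v).
Proof. by move=> sv i j l; rewrite -!scalerAr; apply: WZ. Qed.

Lemma tstableN v : stab v -> stab (- v).
Proof. by rewrite -scaleN1r; apply: tstableZ. Qed.

Lemma tstable0 v : stab v -> stab 0.
Proof. by rewrite -[0](scale0r v); apply: tstableZ. Qed.

Lemma tstableMa v : stab v -> stab (a * v).
Proof.
move=> sv i j k; have := sv (~~ i) j k.
by rewrite -mul_involX // mul_commX // (mul_commX _ _ abC) (mul_commX _ _ acC).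
Qed.

Lemma tstable_rot v : stab v -> tstable b c a v.
Proof.
move=> sv i j k; have := sv k i j; case: k; rewrite ?expr0 ?expr1 ?mul1r //.
by rewrite (mul_commX _ _ abC) (mul_commX _ _ acC).
Qed.

(** If c can be traded for a up to elements already treated, then c * v is
a * v plus such elements, and the monomials in a and b alone are enough. *)
Lemma tstable_half v : stab ((c * a - 1) * v) ->
  (forall i j : bool, W (a ^+ i * (b ^+ j * v))) -> stab v.
Proof.
move=> sv Wv i j [|]; last by rewrite expr0 mul1r.
have cE : c * v = a * v + a * ((c * a - 1) * v).
  rewrite mulrBl mul1r mulrBr addrC subrK -acC !mulrA -expr2 aK mul1r //.
rewrite expr1 cE !mulrDr; apply: WD.
  have := Wv (~~ i) j.
  by rewrite -mul_involX // mul_commX // (mul_commX _ _ abC).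
by have := tstableMa sv i j false; rewrite expr0 mul1r.
Qed.

End Fixed.

End TorusStable.

(** Since q ^+ 2 = 1, the factor 1 + q kills q - 1. *)
Lemma elim_invol (A : pzRingType) (p q x y : A) :
    q ^+ 2 = 1 -> (p - 1) * x + (q - 1) * y = 0 ->
  (1 + q) * ((p - 1) * x) = 0.
Proof.
rewrite expr2 => qq /(congr1 ( *%R (1 + q))).
have z : (1 + q) * (q - 1) = 0.
  by rewrite mulrBr mulr1 mulrDl mul1r qq [q + 1]addrC subrr.
by rewrite mulr0 mulrDr [X in _ + X]mulrA z mul0r addr0.
Qed.

(** For involutions p, q, r, each the product of the two others, the products
(1 + q) (p - 1) and (1 + r) (q - 1) are multiples of the projections onto the
two kinds of characters on which p is -1. *)
Lemma double_invol (A : pzRingType) (p q r v : A) :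
    q * p = r -> r * q = p ->
  (1 + q) * ((p - 1) * v) + (1 + r) * ((q - 1) * v) = (p - 1) * v *+ 2.
Proof.
move=> qp rq; rewrite !mulrA -mulrDl mulr2n -mulrDl; congr (_ * v).
rewrite !mulrDl !mul1r !mulrBr !mulr1 qp rq.
have -> : q - 1 + (p - r) = p - 1 + - (r - q).
  by rewrite addrC addrACA [_ - 1]addrC addrACA opprB.
by rewrite addrACA subrr addr0.
Qed.

Section Spanning.

Variables (K : fieldType) (u : K) (A : algType K) (g1 g2 t1 t2 t3 : A).
Hypothesis two_neq0 : 2 != 0 :> K.
Hypothesis H : ytl_rels u eq g1 g2 t1 t2 t3.

(** The difference between x St y and St, where St is the Steinberg relation.
The elements [y1], [y2], ... are the conjugates of [y] by g1, g2, g1 g2, g2 g1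
and g1 g2 g1; the last hypothesis makes the terms in g1 g2 g1 cancel. *)
Lemma stein_conj x y y1 y2 y12 y21 y121 :
    g1 * y = y1 * g1 -> g2 * y = y2 * g2 -> g1 * y2 = y12 * g1 ->
    g2 * y1 = y21 * g2 -> g1 * y21 = y121 * g1 -> x * y121 = 1 ->
  (x * y - 1) + (x * y1 - 1) * g1 + (x * y2 - 1) * g2
    + (x * y12 - 1) * (g1 * g2) + (x * y21 - 1) * (g2 * g1) = 0.
Proof.
move=> e1 e2 e12 e21 e121 xy.
pose st := 1 + g1 + g2 + g1 * g2 + g2 * g1 + g1 * g2 * g1.
have st0 : st = 0.
  by rewrite -(ytl_stein H) /st (ACl (6*4*5*2*3*1)).
transitivity (x * st * y - st); last by rewrite st0 mulr0 mul0r subr0.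
have -> : x * st * y = x * y + x * y1 * g1 + x * y2 * g2 + x * y12 * (g1 * g2)
    + x * y21 * (g2 * g1) + g1 * g2 * g1.
  rewrite /st !(mulrDr, mulrDl) mulr1 -!(mulrA x) -!(mulrA g1) -!(mulrA g2).
  rewrite e1 e2 !(mulrA g2 y1) e21 -!(mulrA y21) !(mulrA g1 y2) e12.
  rewrite !(mulrA g1 y21) e121 -!(mulrA y121) (mulrA x y121) xy mul1r.
  by rewrite !mulrA.
rewrite /st !mulrBl !mul1r !opprD.
by rewrite !addrA [RHS](ACl (1*7*2*8*3*9*4*10*5*11*(6*12))) /= subrr addr0.
Qed.

Let t1K := ytl_t1K H.
Let t2K := ytl_t2K H.
Let t3K := ytl_t3K H.
Let t12C := ytl_t12C H.
Let t13C := ytl_t13C H.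
Let t23C := ytl_t23C H.

Lemma stein_t2 :
  (t1 * t2 - 1) * (g1 + g2 * g1) + (t2 * t3 - 1) * (g2 + g1 * g2) = 0.
Proof.
have := stein_conj (ytl_g1t2 H) (ytl_g2t2 H) (ytl_g1t3 H) (ytl_g2t1 H)
  (ytl_g1t1 H) t2K.
rewrite -expr2 t2K subrr add0r -t12C => <-; rewrite !mulrDr.
by rewrite !addrA [RHS](ACl (1*4*2*3)).
Qed.

Lemma stein_t13 :
  (t1 * t3 - 1) * (1 + g1) + (t1 * t2 - 1) * (g2 + g2 * g1) = 0.
Proof.
have := stein_conj (ytl_g1t3 H) (ytl_g2t3 H) (ytl_g1t2 H) (ytl_g2t3 H)
  (ytl_g1t2 H) t1K.
by rewrite -expr2 t1K subrr mul0r addr0 => <-; rewrite !mulrDr mulr1 !addrA.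
Qed.

Lemma stein_t31 :
  (t1 * t3 - 1) * (1 + g2) + (t2 * t3 - 1) * (g1 + g1 * g2) = 0.
Proof.
have := stein_conj (ytl_g1t1 H) (ytl_g2t1 H) (ytl_g1t1 H) (ytl_g2t2 H)
  (ytl_g1t3 H) t3K.
rewrite -expr2 t3K subrr mul0r addr0 -t13C -t23C => <-; rewrite !mulrDr mulr1.
by rewrite !addrA [RHS](ACl (1*3*2*4)).
Qed.

Notation W := (in_span (ytl_words g1 g2 t1 t2 t3)).
Notation stab := (tstable W t1 t2 t3).

Let WD := @in_spanD _ _ _ (ytl_words g1 g2 t1 t2 t3).
Let WZ := @in_spanZ _ _ _ (ytl_words g1 g2 t1 t2 t3).
Let Wn i (lt_i : (i < 28)%N) := in_span_nth (ytl_words g1 g2 t1 t2 t3) lt_i.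

Lemma stab_t1 v : stab v -> stab (t1 * v).
Proof. exact: tstableMa. Qed.

Lemma stab_rot v : stab v -> tstable W t2 t3 t1 v.
Proof. exact: tstable_rot. Qed.

Lemma stab_rot2 v : tstable W t2 t3 t1 v -> tstable W t3 t1 t2 v.
Proof. exact: tstable_rot. Qed.

Lemma stab_rot3 v : tstable W t3 t1 t2 v -> stab v.
Proof. exact: tstable_rot. Qed.

Lemma stab_t2 v : stab v -> stab (t2 * v).
Proof. by move=> /stab_rot sv; apply/stab_rot3/stab_rot2; apply: tstableMa. Qed.

Lemma stab_t3 v : stab v -> stab (t3 * v).
Proof. by move=> /stab_rot/stab_rot2 sv; apply/stab_rot3; apply: tstableMa. Qed.

Lemma stabD v w : stab v -> stab w -> stab (v + w).
Proof. exact: tstableD. Qed.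

Lemma stabZ k v : stab v -> stab (k *: v).
Proof. exact: tstableZ. Qed.

Lemma stab_addr0 v w : v + w = 0 -> stab w -> stab v.
Proof. by move=> /eqP; rewrite addr_eq0 => /eqP ->; apply: tstableN. Qed.

Definition stab_op x := forall v, stab v -> stab (x * v).

Lemma stab_opM x y : stab_op x -> stab_op y -> stab_op (x * y).
Proof. by move=> sx sy v sv; rewrite -mulrA; apply/sx/sy. Qed.

Lemma stab_op1D x : stab_op x -> stab_op (1 + x).
Proof.
by move=> sx v sv; rewrite mulrDl mul1r; apply: stabD => //; apply: sx.
Qed.

Lemma stab_opB1 x : stab_op x -> stab_op (x - 1).
Proof.
move=> sx v sv; rewrite mulrBl mul1r.
by apply: stabD; [apply: sx | apply: tstableN].
Qed.

Let op12 : stab_op (t1 * t2) := stab_opM stab_t1 stab_t2.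
Let op13 : stab_op (t1 * t3) := stab_opM stab_t1 stab_t3.
Let op23 : stab_op (t2 * t3) := stab_opM stab_t2 stab_t3.

Lemma stab_g1g2 : stab (g1 * g2).
Proof.
case=> [] [] []; rewrite ?expr0 ?expr1 ?mul1r ?mulrA.
- exact: (@Wn 19 isT).
- exact: (@Wn 16 isT).
- exact: (@Wn 17 isT).
- exact: (@Wn 13 isT).
- exact: (@Wn 18 isT).
- exact: (@Wn 14 isT).
- exact: (@Wn 15 isT).
- exact: (@Wn 12 isT).
Qed.

Lemma stab_g2g1 : stab (g2 * g1).
Proof.
case=> [] [] []; rewrite ?expr0 ?expr1 ?mul1r ?mulrA.
- exact: (@Wn 27 isT).
- exact: (@Wn 24 isT).
- exact: (@Wn 25 isT).
- exact: (@Wn 21 isT).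
- exact: (@Wn 26 isT).
- exact: (@Wn 22 isT).
- exact: (@Wn 23 isT).
- exact: (@Wn 20 isT).
Qed.

Let invol2 x y : x * y = y * x -> x ^+ 2 = 1 -> y ^+ 2 = 1 ->
  (x * y) ^+ 2 = 1 :> A.
Proof. by move=> xy xx yy; rewrite (exprMn_comm _ xy) xx yy mulr1. Qed.

Let t12K : (t1 * t2) ^+ 2 = 1. Proof. exact: invol2. Qed.
Let t13K : (t1 * t3) ^+ 2 = 1. Proof. exact: invol2. Qed.
Let t23K : (t2 * t3) ^+ 2 = 1. Proof. exact: invol2. Qed.

Let m23_12 : (t2 * t3) * (t1 * t2) = t1 * t3.
Proof. by rewrite t12C t23C mulrA -(mulrA t3) -expr2 t2K mulr1 t13C. Qed.
Let m13_23 : (t1 * t3) * (t2 * t3) = t1 * t2.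
Proof. by rewrite t23C mulrA -(mulrA t1) -expr2 t3K mulr1. Qed.
Let m12_23 : (t1 * t2) * (t2 * t3) = t1 * t3.
Proof. by rewrite mulrA -(mulrA t1) -expr2 t2K mulr1. Qed.
Let m13_12 : (t1 * t3) * (t1 * t2) = t2 * t3.
Proof. by rewrite {1}t13C mulrA -(mulrA t3) -expr2 t1K mulr1 t23C. Qed.

Lemma stab_double v : stab (v *+ 2) -> stab v.
Proof.
by move=> /(stabZ 2^-1); rewrite -scaler_nat scalerA mulVf // scale1r.
Qed.

(** Each half of [(t1 t2 - 1) g1], on the characters where the first sign is
isolated and on those where the second one is, equals a multiple of g2 g1 or
of g1 g2. So t1 g1 can be replaced by t2 g1. *)
Lemma stab_g1 : stab g1.
Proof.
apply/stab_rot3/stab_rot2; apply: tstable_half => //; last first.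
  case=> [] []; rewrite ?expr0 ?expr1 ?mul1r ?mulrA.
  - exact: (@Wn 7 isT).
  - exact: (@Wn 5 isT).
  - exact: (@Wn 6 isT).
  - exact: (@Wn 4 isT).
apply: stab_rot; apply: stab_double.
rewrite -(double_invol _ m23_12 m13_23); apply: stabD.
  apply: (@stab_addr0 _ ((1 + t2 * t3) * ((t1 * t2 - 1) * (g2 * g1)))).
    by rewrite -!mulrDr; apply: elim_invol t23K stein_t2.
  by apply/(stab_op1D op23)/(stab_opB1 op12)/stab_g2g1.
apply: (@stab_addr0 _ ((1 + t1 * t3) * ((t2 * t3 - 1) * (g1 * g2)))).
  rewrite -!mulrDr; apply: elim_invol t13K _; rewrite addrC.
  exact: stein_t31.
by apply/(stab_op1D op13)/(stab_opB1 op23)/stab_g1g2.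
Qed.

(** In the same way, t2 g2 can be replaced by t3 g2. *)
Lemma stab_g2 : stab g2.
Proof.
apply/stab_rot3; apply: tstable_half => //; last first.
  case=> [] []; rewrite ?expr0 ?expr1 ?mul1r ?mulrA -?t13C.
  - exact: (@Wn 11 isT).
  - exact: (@Wn 10 isT).
  - exact: (@Wn 9 isT).
  - exact: (@Wn 8 isT).
apply/stab_rot2/stab_rot; apply: stab_double.
rewrite -(double_invol _ m12_23 m13_12); apply: stabD.
  apply: (@stab_addr0 _ ((1 + t1 * t2) * ((t2 * t3 - 1) * (g1 * g2)))).
    rewrite -!mulrDr; apply: elim_invol t12K _; rewrite addrC.
    exact: stein_t2.
  by apply/(stab_op1D op12)/(stab_opB1 op23)/stab_g1g2.
apply: (@stab_addr0 _ ((1 + t1 * t3) * ((t1 * t2 - 1) * (g2 * g1)))).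
  rewrite -!mulrDr; apply: elim_invol t13K _; rewrite addrC.
  exact: stein_t13.
by apply/(stab_op1D op13)/(stab_opB1 op12)/stab_g2g1.
Qed.

(** A single relation gives t1 t3 - 1 in terms of words already treated, so that
t3 can be replaced by t1. *)
Lemma stab_1 : stab 1.
Proof.
apply: tstable_half => //; last first.
  case=> [] []; rewrite ?expr0 ?expr1 ?mul1r ?mulr1.
  - exact: (@Wn 3 isT).
  - exact: (@Wn 1 isT).
  - exact: (@Wn 2 isT).
  - exact: (@Wn 0 isT).
rewrite -t13C.
apply: (@stab_addr0 _ ((t1 * t3 - 1) * g1
                       + (t1 * t2 - 1) * (g2 + g2 * g1))).
  by rewrite addrA -mulrDr stein_t13.
apply: stabD; first exact/(stab_opB1 op13)/stab_g1.
by apply/(stab_opB1 op12)/stabD; [exact: stab_g2 | exact: stab_g2g1].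
Qed.

Lemma stab_g1g2g1 : stab (g1 * g2 * g1).
Proof.
have := ytl_stein H; rewrite -!addrA => /stab_addr0; apply.
apply/(stabD stab_g1g2)/(stabD stab_g2g1)/(stabD stab_g1)/(stabD stab_g2).
exact: stab_1.
Qed.

Lemma stab_quad x e v : stab_op e ->
    x ^+ 2 = 1 + (u - 1) *: (2^-1 *: (1 + e))
               + (u - 1) *: (2^-1 *: (1 + e) * x) ->
  stab v -> stab (x * v) -> stab (x * (x * v)).
Proof.
move=> oe xx sv sxv; rewrite mulrA -expr2 xx !mulrDl mul1r -!scalerAl -mulrA.
have oe1 := stab_op1D oe.
by apply: stabD; [apply: stabD => //|]; do 2!apply: stabZ; apply: oe1.
Qed.

(** This condition passes from [v] to t_j v, as g_i t_j v is some t_k g_i v; it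
need only be verified on the five words in g1 and g2. *)
Definition stab_g v := [/\ stab v, stab (g1 * v) & stab (g2 * v)].

Lemma stab_g_t1 v : stab_g v -> stab_g (t1 * v).
Proof.
case=> s s1 s2; split; first exact: stab_t1.
  by rewrite mulrA (ytl_g1t1 H) -mulrA; apply: stab_t2.
by rewrite mulrA (ytl_g2t1 H) -mulrA; apply: stab_t1.
Qed.

Lemma stab_g_t2 v : stab_g v -> stab_g (t2 * v).
Proof.
case=> s s1 s2; split; first exact: stab_t2.
  by rewrite mulrA (ytl_g1t2 H) -mulrA; apply: stab_t1.
by rewrite mulrA (ytl_g2t2 H) -mulrA; apply: stab_t3.
Qed.

Lemma stab_g_t3 v : stab_g v -> stab_g (t3 * v).
Proof.
case=> s s1 s2; split; first exact: stab_t3.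
  by rewrite mulrA (ytl_g1t3 H) -mulrA; apply: stab_t3.
by rewrite mulrA (ytl_g2t3 H) -mulrA; apply: stab_t2.
Qed.

Lemma stab_g_words : [/\ stab_g 1, stab_g g1, stab_g g2,
  stab_g (g1 * g2) & stab_g (g2 * g1)].
Proof.
have q1 v := @stab_quad g1 _ v op12 (ytl_quad1 H).
have q2 v := @stab_quad g2 _ v op23 (ytl_quad2 H).
have [s1 sg1 sg2 sg12 sg21] :=
  And5 stab_1 stab_g1 stab_g2 stab_g1g2 stab_g2g1.
split; split; rewrite ?mulr1 //.
- by rewrite -[g1 * g1]mulr1 -mulrA; apply: q1; rewrite ?mulr1.
- by rewrite -[g2 * g2]mulr1 -mulrA; apply: q2; rewrite ?mulr1.
- exact: q1.
- by rewrite mulrA -(ytl_braid H); apply: stab_g1g2g1.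
- by rewrite mulrA; apply: stab_g1g2g1.
- exact: q2.
Qed.

Lemma stab_g_span v : W v -> stab_g v.
Proof.
have [s1 sg1 sg2 sg12 sg21] := stab_g_words.
move: v; apply: in_span_ind.
- by move=> v w [? ? ?] [? ? ?]; split; rewrite ?mulrDr; apply: stabD.
- by move=> k v [? ? ?]; split; rewrite -?scalerAr; apply: stabZ.
- by have [z _ _] := s1; split; rewrite ?mulr0; apply: tstable0 z.
have t1E := stab_g_t1 s1; have t2E := stab_g_t2 s1; rewrite !mulr1 in t1E t2E.
do 28![case; first by move=> _ /=; rewrite -?mulrA //;
  repeat first [assumption | apply: stab_g_t1 | apply: stab_g_t2
    | apply: stab_g_t3]].
by [].
Qed.

Lemma span_1 : W 1.
Proof. exact: (@Wn 0 isT). Qed.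

Lemma span_closed v : W v ->
  [/\ W (t1 * v), W (t2 * v), W (t3 * v), W (g1 * v) & W (g2 * v)].
Proof.
move=> /stab_g_span [s s1 s2]; split; apply: tstableW.
- exact: stab_t1.
- exact: stab_t2.
- exact: stab_t3.
- exact: s1.
- exact: s2.
Qed.

End Spanning.

(** * Linear independence *)

Section SignPolynomials.

Variables (K : fieldType) (A : algType K).

Definition poly4 (c : nat -> K) (x y : A) : A :=
  c 0%N *: 1 + c 1%N *: x + c 2%N *: y + c 3%N *: (x * y).

Definition poly8 (c : nat -> K) (x y z : A) : A :=
  c 0%N *: 1 + c 1%N *: x + c 2%N *: y + c 3%N *: z + c 4%N *: (x * y)
    + c 5%N *: (x * z) + c 6%N *: (y * z) + c 7%N *: (x * y * z).

(** The linear combination of the 28 elements with coefficients [c], grouped by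
the word in g1 and g2. *)
Definition ytl_comb (c : nat -> K) (g1 g2 t1 t2 t3 : A) : A :=
  poly4 c t1 t2 + poly4 (c \o addn 4) t2 t3 * g1
    + poly4 (c \o addn 8) t1 t3 * g2
    + poly8 (c \o addn 12) t1 t2 t3 * (g1 * g2)
    + poly8 (c \o addn 20) t1 t2 t3 * (g2 * g1).

Lemma ytl_words_sum (c : nat -> K) (g1 g2 t1 t2 t3 : A) :
  \sum_(i < 28) c i *: tnth (ytl_words g1 g2 t1 t2 t3) i
    = ytl_comb c g1 g2 t1 t2 t3.
Proof.
under eq_bigr => i _ do rewrite (tnth_nth 0).
rewrite -(big_mkord xpredT
  (fun i => c i *: (ytl_words g1 g2 t1 t2 t3)`_i)).
rewrite /index_iota /= !big_cons big_nil addr0 /=.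
rewrite /ytl_comb /poly4 /poly8 /= !mulrDl -!scalerAl !mul1r !mulrA !addrA.
by [].
Qed.

End SignPolynomials.

Lemma ytl_comb_morph (K : fieldType) (A B : algType K) (phi : A -> B) c
    (g1 g2 t1 t2 t3 : A) :
    linear phi -> phi 1 = 1 -> {morph phi : x y / x * y} ->
  phi (ytl_comb c g1 g2 t1 t2 t3)
    = ytl_comb c (phi g1) (phi g2) (phi t1) (phi t2) (phi t3).
Proof.
move=> phiL phi1 phiM.
have phiD x y : phi (x + y) = phi x + phi y.
  by rewrite -[x]scale1r phiL !scale1r.
have phi0 : phi 0 = 0.
  by apply: (addrI (phi 0)); rewrite -phiD !addr0.
have phiZ k x : phi (k *: x) = k *: phi x.
  by rewrite -[k *: x]addr0 phiL phi0 addr0.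
by rewrite /ytl_comb /poly4 /poly8 !(phiD, phiM, phiZ, phi1).
Qed.

Section Matrices3.

Variable K : fieldType.

Definition mx3 (a b c d e f g h i : K) : 'M[K]_3 :=
  \matrix_(x < 3, y < 3)
    nth 0 (nth [::] [:: [:: a; b; c]; [:: d; e; f]; [:: g; h; i]] x) y.

Lemma mx3_eq (M N : 'M[K]_3) :
    M 0 0 = N 0 0 -> M 0 1 = N 0 1 -> M 0 2 = N 0 2 ->
    M 1 0 = N 1 0 -> M 1 1 = N 1 1 -> M 1 2 = N 1 2 ->
    M 2 0 = N 2 0 -> M 2 1 = N 2 1 -> M 2 2 = N 2 2 ->
  M = N.
Proof.
by move=> *; apply/matrixP => x y;
  case: (ord3_cases x) => ->; case: (ord3_cases y) => ->.
Qed.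

Lemma mx3M a b c d e f g h i a' b' c' d' e' f' g' h' i' :
  mx3 a b c d e f g h i * mx3 a' b' c' d' e' f' g' h' i' =
  mx3 (a * a' + b * d' + c * g') (a * b' + b * e' + c * h')
      (a * c' + b * f' + c * i')
      (d * a' + e * d' + f * g') (d * b' + e * e' + f * h')
      (d * c' + e * f' + f * i')
      (g * a' + h * d' + i * g') (g * b' + h * e' + i * h')
      (g * c' + h * f' + i * i').
Proof.
by apply: mx3_eq; rewrite !mxE !big_ord_recl big_ord0 !mxE /= addr0 addrA.
Qed.

Lemma mx3D a b c d e f g h i a' b' c' d' e' f' g' h' i' :
  mx3 a b c d e f g h i + mx3 a' b' c' d' e' f' g' h' i' =
  mx3 (a + a') (b + b') (c + c') (d + d') (e + e') (f + f')
      (g + g') (h + h') (i + i').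
Proof. by apply: mx3_eq; rewrite !mxE. Qed.

Lemma mx3Z k a b c d e f g h i :
  k *: mx3 a b c d e f g h i =
  mx3 (k * a) (k * b) (k * c) (k * d) (k * e) (k * f) (k * g) (k * h) (k * i).
Proof. by apply: mx3_eq; rewrite !mxE. Qed.

Lemma mx3_1 : 1 = mx3 1 0 0 0 1 0 0 0 1.
Proof. by apply: mx3_eq; rewrite !mxE. Qed.

Lemma mx3_0 : 0 = mx3 0 0 0 0 0 0 0 0 0.
Proof. by apply: mx3_eq; rewrite !mxE. Qed.

Lemma mx3_inj a b c d e f g h i a' b' c' d' e' f' g' h' i' :
    mx3 a b c d e f g h i = mx3 a' b' c' d' e' f' g' h' i' ->
  [/\ [/\ a = a', b = b' & c = c'], [/\ d = d', e = e' & f = f']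
    & [/\ g = g', h = h' & i = i']].
Proof.
move=> /matrixP E.
have := (E 0 0, E 0 1, E 0 2, E 1 0, E 1 1, E 1 2, E 2 0, E 2 1, E 2 2).
by rewrite !mxE /= => -[[[[[[[[-> ->] ->] ->] ->] ->] ->] ->] ->].
Qed.

Definition diag3 (x y z : K) := mx3 x 0 0 0 y 0 0 0 z.

Definition mx3E := (mx3M, mx3D, mx3Z, mx3_1, mx3_0).

End Matrices3.

(** The parameter [b] is u - 1 if y = x, and 0 if y = - x, in which case g1 and
g2 permute the basis vectors up to signs. On the vectors that it moves, g_i
satisfies g_i ^+ 2 = (1 + b) + b g_i; on the remaining one it is -1, which is
also a root of that quadratic. *)
Section Representation.

Variables (K : fieldType) (u b x y : K).
Hypotheses (bE : b = (u - 1) * (2^-1 * (1 + x * y))).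
Hypotheses (xx : x * x = 1) (yy : y * y = 1).

Definition rep_g1 : 'M[K]_3 := mx3 0 (1 + b) 0 1 b 0 0 0 (-1).
Definition rep_g2 : 'M[K]_3 := mx3 (-1) 0 0 0 0 (1 + b) 0 1 b.
Definition rep_t1 : 'M[K]_3 := diag3 y x x.
Definition rep_t2 : 'M[K]_3 := diag3 x y x.
Definition rep_t3 : 'M[K]_3 := diag3 x x y.

Lemma rep_rels : ytl_rels u eq rep_g1 rep_g2 rep_t1 rep_t2 rep_t3.
Proof.
have bxE : b * x = y * b.
  rewrite bE; move: 2^-1 => w; transitivity ((u - 1) * w * (x + x * x * y)).
    by ring.
  rewrite xx mul1r.
  transitivity ((u - 1) * w * (y + x * (y * y))); last by ring.
  by rewrite yy mulr1 (addrC x y).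
have byE : b * y = x * b.
  rewrite bE; move: 2^-1 => w; transitivity ((u - 1) * w * (y + x * (y * y))).
    by ring.
  rewrite yy mulr1; transitivity ((u - 1) * w * (x + x * x * y)); last by ring.
  by rewrite xx mul1r (addrC x y).
split; rewrite /rep_g1 /rep_g2 /rep_t1 /rep_t2 /rep_t3 /diag3 ?expr2 !mx3E.
- by congr mx3; ring.
- by rewrite bE; move: 2^-1 => w; congr mx3; ring.
- by rewrite bE; move: 2^-1 => w; congr mx3; ring.
- by congr mx3; ring.
- by congr mx3; ring.
- by congr mx3; ring.
- by rewrite ?xx ?yy; congr mx3; ring.
- by rewrite ?xx ?yy; congr mx3; ring.
- by rewrite ?xx ?yy; congr mx3; ring.
- by rewrite bxE; congr mx3; ring.
- by rewrite byE; congr mx3; ring.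
- by congr mx3; ring.
- by congr mx3; ring.
- by rewrite bxE; congr mx3; ring.
- by rewrite byE; congr mx3; ring.
- by congr mx3; ring.
Qed.

Definition sign4 (c : nat -> K) (r s : K) : K :=
  c 0%N + c 1%N * r + c 2%N * s + c 3%N * (r * s).

Definition sign8 (c : nat -> K) (r s t : K) : K :=
  c 0%N + c 1%N * r + c 2%N * s + c 3%N * t + c 4%N * (r * s)
    + c 5%N * (r * t) + c 6%N * (s * t) + c 7%N * (r * s * t).

Lemma poly4_diag c r1 r2 r3 s1 s2 s3 :
  poly4 c (diag3 r1 r2 r3) (diag3 s1 s2 s3)
    = diag3 (sign4 c r1 s1) (sign4 c r2 s2) (sign4 c r3 s3).
Proof.
by rewrite /poly4 /diag3 !mx3E /sign4; congr mx3; ring.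
Qed.

Lemma poly8_diag c r1 r2 r3 s1 s2 s3 t1 t2 t3 :
  poly8 c (diag3 r1 r2 r3) (diag3 s1 s2 s3) (diag3 t1 t2 t3)
    = diag3 (sign8 c r1 s1 t1) (sign8 c r2 s2 t2) (sign8 c r3 s3 t3).
Proof.
by rewrite /poly8 /diag3 !mx3E /sign8; congr mx3; ring.
Qed.

(** In the i-th row, T acts by the character with y in position i, and the
functions [F0], ..., [F21] are the coefficients of the five words. *)
Section Rows.

Variable c : nat -> K.
Notation F0 := (sign4 c).
Notation F1 := (sign4 (c \o addn 4)).
Notation F2 := (sign4 (c \o addn 8)).
Notation F12 := (sign8 (c \o addn 12)).
Notation F21 := (sign8 (c \o addn 20)).

Lemma rep_rows : 1 + b != 0 ->
    ytl_comb c rep_g1 rep_g2 rep_t1 rep_t2 rep_t3 = 0 ->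
  [/\ [/\ F0 y x = F2 y x, F1 x x = F21 y x x & F12 y x x = 0],
      [/\ F1 y x = F12 x y x, F0 x y + b * F1 y x = 0
        & F2 x x + b * F12 x y x = F21 x y x]
    & [/\ F21 x x y = 0, F2 x y = F12 x x y
        & F0 x x - F1 x y + b * F2 x y - b * F12 x x y = 0]].
Proof.
move=> a0; rewrite /ytl_comb /rep_t1 /rep_t2 /rep_t3 !(poly4_diag, poly8_diag).
rewrite /rep_g1 /rep_g2 /diag3.
move: (F0 y x) (F0 x y) (F0 x x) (F1 x x) (F1 y x) (F1 x y).
move: (F2 y x) (F2 x x) (F2 x y) (F12 y x x) (F12 x y x) (F12 x x y).
move: (F21 y x x) (F21 x y x) (F21 x x y).
move=> k1 k2 k3 h1 h2 h3 f1 f2 f3 d1 d2 d3 e1 e2 e3.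
rewrite !mx3E => /mx3_inj [[E11 E12 E13] [E21 E22 E23] [E31 E32 E33]].
have regE z : (1 + b) * z = 0 -> z = 0.
  by move/eqP; rewrite mulf_eq0 (negPf a0) => /eqP.
have z3 : k3 = 0 by rewrite -E31; ring.
split; split=> //.
- by apply/eqP; rewrite -subr_eq0 -E11; apply/eqP; ring.
- apply/eqP; rewrite -subr_eq0; apply/eqP; apply: (regE _); rewrite -E12; ring.
- by do 2!apply: (regE _); rewrite -E13; ring.
- by apply/eqP; rewrite -subr_eq0 -E21; apply/eqP; ring.
- by rewrite -E22; ring.
- apply/eqP; rewrite -subr_eq0; apply/eqP; apply: (regE _); rewrite -E23; ring.
- by apply/eqP; rewrite -subr_eq0 -[X in _ == X]E32 z3; apply/eqP; ring.
- by rewrite -E33 z3; ring.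
Qed.

End Rows.

End Representation.

Section SignInversion.

Variable K : fieldType.
Hypothesis two_neq0 : 2 != 0 :> K.

Lemma half_sum_eq0 (p q : K) : p + q = 0 -> p - q = 0 -> p = 0 /\ q = 0.
Proof.
move=> pq0 /eqP; rewrite subr_eq0 => /eqP pq; move: pq0; rewrite pq -mulr2n.
by rewrite -mulr_natr => /eqP; rewrite mulf_eq0 (negPf two_neq0) orbF => /eqP.
Qed.

Lemma sign4_eq0 (c : nat -> K) :
    (forall i j : bool, sign4 c ((-1) ^+ i) ((-1) ^+ j) = 0) ->
  [/\ c 0%N = 0, c 1%N = 0, c 2%N = 0 & c 3%N = 0].
Proof.
move=> E; have D (i : bool) :
    c 0%N + c 2%N * (-1) ^+ i = 0 /\ c 1%N + c 3%N * (-1) ^+ i = 0.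
  by apply: half_sum_eq0; [rewrite -(E false i) | rewrite -(E true i)];
    rewrite /sign4 ?expr0 ?expr1; ring.
move: (D false) (D true); rewrite expr0 expr1 !mulr1 !mulrN1.
move=> [D0 D1] [D0' D1'].
by have [-> ->] := half_sum_eq0 D0 D0'; have [-> ->] := half_sum_eq0 D1 D1'.
Qed.

(** With the last sign fixed, the polynomial is one in two signs. *)
Lemma sign8_eq0 (c : nat -> K) :
    (forall i j k : bool,
       sign8 c ((-1) ^+ i) ((-1) ^+ j) ((-1) ^+ k) = 0) ->
  forall n, (n < 8)%N -> c n = 0.
Proof.
move=> E; pose d (k : bool) n := [:: c 0%N + c 3%N * (-1) ^+ k;
  c 1%N + c 5%N * (-1) ^+ k; c 2%N + c 6%N * (-1) ^+ k;
  c 4%N + c 7%N * (-1) ^+ k]`_n.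
have D k : [/\ d k 0%N = 0, d k 1%N = 0, d k 2%N = 0 & d k 3%N = 0].
  by apply: sign4_eq0 => i j; rewrite -(E i j k) /sign4 /sign8 /d /=; ring.
move: (D false) (D true); rewrite /d /= expr0 expr1 !mulr1 !mulrN1.
move=> [E0 E1 E2 E3] [E0' E1' E2' E3'].
have [c0 c3] := half_sum_eq0 E0 E0'; have [c1 c5] := half_sum_eq0 E1 E1'.
have [c2 c6] := half_sum_eq0 E2 E2'; have [c4 c7] := half_sum_eq0 E3 E3'.
by do 8![case=> [|] //].
Qed.

End SignInversion.

Section Basis.

Variables (K : fieldType) (u : K).
Hypotheses (two_neq0 : 2 != 0 :> K) (u_neq0 : u != 0).

(** For y = x all five coefficients vanish at the constant triple. With these
values, the equations for y = - x give first the coefficient of 1, then those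
of g1 and g2, then those of g1 g2 and g2 g1, at all other triples. *)
Lemma ytl_comb_coef0 (c : nat -> K) :
    ytl_comb c (ytl_g u 0) (ytl_g u 1)
      (ytl_t u 0) (ytl_t u 1) (ytl_t u 2) = 0 ->
  forall n, (n < 28)%N -> c n = 0.
Proof.
move=> c0.
have rows (e f : bool) (x := (-1) ^+ e : K) (y := (-1) ^+ f : K)
    (b := if e == f then u - 1 else 0) :
    1 + b != 0 /\
    ytl_comb c (rep_g1 b) (rep_g2 b) (rep_t1 x y) (rep_t2 x y) (rep_t3 x y) = 0.
  split.
    by rewrite /b; case: ifP => _; rewrite ?addr0 ?oner_eq0 // addrC subrK.
  have [||| phi phiL [phi1 phiM [p1 p2] [q1 q2 q3]]] :=
      ytl23_lift (@rep_rels K u b x y _ _ _).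
  - by rewrite /b /x /y; case: (e) (f) => [] [] /=; field.
  - by rewrite /x -expr2 sqrr_sign.
  - by rewrite /y -expr2 sqrr_sign.
  rewrite -p1 -p2 -q1 -q2 -q3 -ytl_comb_morph // c0.
  by have := phiL (-1) 0 0; rewrite scaler0 addr0 scaleN1r addNr.
pose s (e : bool) : K := (-1) ^+ e.
have {}rows (e f : bool) := rep_rows (rows e f).1 (rows e f).2.
have diag e : [/\ sign4 c (s e) (s e) = 0,
    sign4 (c \o addn 4) (s e) (s e) = 0, sign4 (c \o addn 8) (s e) (s e) = 0,
    sign8 (c \o addn 12) (s e) (s e) (s e) = 0
    & sign8 (c \o addn 20) (s e) (s e) (s e) = 0].
  have [[A1 A2 A3] _ [C1 C2 _]] := rows e e; rewrite -/(s e) in A1 A2 A3 C1 C2.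
  by split; rewrite ?A1 ?A2 ?C2.
have off0 e f : e != f -> sign4 c (s e) (s f) = 0.
  move=> /negPf ef; have [_ [_ B2 _] _] := rows e f.
  by move: B2; rewrite ef mul0r addr0.
have off1 e f : e != f -> sign4 (c \o addn 4) (s e) (s f) = 0.
  move=> ef; have [_ _ [_ _]] := rows e f; have [D0 _ _ _ _] := diag e.
  rewrite -/(s e) -/(s f) (negPf ef) D0 !mul0r subr0 addr0 sub0r.
  by move=> /eqP; rewrite oppr_eq0 => /eqP.
have off2 e f : e != f -> sign4 (c \o addn 8) (s e) (s f) = 0.
  move=> ef; have [[<- _ _] _ _] := rows f e.
  exact: off0.
have off12 e f : e != f -> [/\ sign8 (c \o addn 12) (s f) (s e) (s e) = 0,
    sign8 (c \o addn 12) (s e) (s f) (s e) = 0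
    & sign8 (c \o addn 12) (s e) (s e) (s f) = 0].
  move=> ef; have [[_ _ A3] [B1 _ _] [_ C2 _]] := rows e f; split=> //.
    by rewrite -[LHS]B1; apply: off1; rewrite eq_sym.
  by rewrite -[LHS]C2; apply: off2.
have off21 e f : e != f -> [/\ sign8 (c \o addn 20) (s f) (s e) (s e) = 0,
    sign8 (c \o addn 20) (s e) (s f) (s e) = 0
    & sign8 (c \o addn 20) (s e) (s e) (s f) = 0].
  move=> ef; have [[_ A2 _] [_ _ B3] [C1 _ _]] := rows e f.
  have [_ D1 D2 _ _] := diag e; split=> //; first by rewrite -[LHS]A2.
  by rewrite -[LHS]B3 (negPf ef) mul0r addr0.
have [a0 a1 a2 a3] : [/\ c 0%N = 0, c 1%N = 0, c 2%N = 0 & c 3%N = 0].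
  apply: (@sign4_eq0 _ two_neq0 c) => i j.
  by have [<-|/off0 //] := eqVneq i j; have [] := diag i.
have [b0 b1 b2 b3] : [/\ c 4%N = 0, c 5%N = 0, c 6%N = 0 & c 7%N = 0].
  apply: (@sign4_eq0 _ two_neq0 (c \o addn 4)) => i j.
  by have [<-|/off1 //] := eqVneq i j; have [] := diag i.
have [d0 d1 d2 d3] : [/\ c 8%N = 0, c 9%N = 0, c 10%N = 0 & c 11%N = 0].
  apply: (@sign4_eq0 _ two_neq0 (c \o addn 8)) => i j.
  by have [<-|/off2 //] := eqVneq i j; have [] := diag i.
(* Among three signs, either all are equal or exactly one is isolated. *)
have tri (F : K -> K -> K -> K) :
    (forall e, F (s e) (s e) (s e) = 0) ->
    (forall e f, e != f -> [/\ F (s f) (s e) (s e) = 0,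
       F (s e) (s f) (s e) = 0 & F (s e) (s e) (s f) = 0]) ->
  forall i j k, F (s i) (s j) (s k) = 0.
  move=> F1 F2 i j k; have [<-|ij] := eqVneq i j.
    by have [<- //|/F2 []] := eqVneq i k.
  have [<-|] := eqVneq i k; first by have [] := F2 _ _ ij.
  move: ij; rewrite eq_sym => ji.
  have [->|] := eqVneq j k.
    by move: ji => _ ik; have [] := F2 k i; rewrite 1?eq_sym.
  by case: (i) (j) (k) ji => [] [] [].
have g12 := @sign8_eq0 _ two_neq0 (c \o addn 12) (tri _ _ off12).
have g21 := @sign8_eq0 _ two_neq0 (c \o addn 20) (tri _ _ off21).
move=> n lt_n; have [lt12|le12] := ltnP n 12.
  by move: n lt12 {lt_n}; do 12![case=> [|]//].
have [lt20|le20] := ltnP n 20.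
  rewrite -(subnKC le12); apply: g12; last by rewrite ltn_subLR.
  by move=> e; have [] := diag e.
rewrite -(subnKC le20); apply: g21; last by rewrite ltn_subLR.
by move=> e; have [] := diag e.
Qed.

Lemma ytl_S_basis : linear_basis (ytl_S u).
Proof.
rewrite ytl_SE; split=> [c c0 i|v].
  pose c' k := c (inord k).
  have <- : c' i = c i by rewrite /c' inord_val.
  apply: ytl_comb_coef0 => //.
  rewrite -ytl_words_sum -[RHS]c0; apply: eq_bigr => j _.
  by rewrite /c' inord_val.
move: v; apply: (@ytl23_ind K u (in_span (ytl_words _ _ _ _ _))).
- exact: in_spanD.
- exact: in_spanZ.
- exact: span_1.
- move=> p Wp; have [_ _ _ g1p g2p] := span_closed two_neq0 (ytl23_rels u) Wp.
  by split; [exact g1p | exact g2p].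
move=> p Wp; have [t1p t2p t3p _ _] := span_closed two_neq0 (ytl23_rels u) Wp.
by split; [exact t1p | exact t2p | exact t3p].
Qed.

End Basis.

(* R ranges over all models of the real numbers, so that R[i] is the field of
   complex numbers. *)
Theorem mainTheorem7 (R : realType) : linear_basis (ytl_S (ratfunC_u R)).
Proof.
apply: ytl_S_basis.
  by rewrite -(rmorph_nat (@tofrac {poly R[i]%C}) 2) tofrac_eq0 -polyC_natr
    polyC_eq0 Num.Theory.pnatr_eq0.
by rewrite /ratfunC_u tofrac_eq0 polyX_eq0.
Qed.
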